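(* Let $q\in(0,1/2)$, let $k\ge 1$ be an integer, $m=2^k$, $r=\tfrac12 q^k$, and let $A=[a_{ij}]\in\mathbb{R}^{m\times m}$ be the matrix with entries $a_{ii}=-\log r$ and $a_{ij}=-\log|w_i-w_j|$ for $i\neq j$, where $w_1<\dots<w_m$ are the midpoints of the $m$ intervals of the $k$-th generalized Cantor approximation $E_k$ (see context). Then $$\log\frac{1}{1-2r}\le a_{ij}\le \log\frac1r,\qquad 1\le i,j\le m,$$ and the entries of $A$ decay away from the diagonal in each row and column, i.e., for all $1\le i,j\le m$, $$a_{i,1}<\dots<a_{i,i-1}<a_{i,i},\qquad a_{i,i}>a_{i,i+1}>\dots>a_{i,m},$$ $$a_{1,j}<\dots<a_{j-1,j}<a_{j,j},\qquad a_{j,j}>a_{j+1,j}>\dots>a_{m,j}.$$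
   Context: For $q\in(0,1/2)$ set $E_0=[0,1]$ and recursively $E_k=qE_{k-1}\cup(qE_{k-1}+1-q)$ for $k\ge1$. The set $E_k$ consists of $m=2^k$ disjoint closed intervals $I_{k,1},\dots,I_{k,m}$, numbered from left to right, each of length $q^k$. For fixed $k$, $w_j$ denotes the midpoint of $I_{k,j}$, and $r=r_k=\tfrac12q^k$, so that $0<r=w_1<w_2<\dots<w_m=1-r<1$. Here $\log$ is the natural logarithm. *)

(* Defs.v *)
From HB Require Import structures.
From mathcomp Require Import all_boot all_order all_algebra.
From mathcomp Require Import all_classical all_reals all_analysis.
From mathcomp Require Import lra.
Set Implicit Arguments.
Unset Strict Implicit.
Unset Printing Implicit Defensive.
Import Order.TTheory GRing.Theory Num.Theory.
Local Open Scope classical_set_scope.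
Local Open Scope ring_scope.

Fixpoint cantor_approx (R : realType) (q : R) (k : nat) : set R :=
  match k with
  | 0%N => [set` `[0, 1]]
  | k'.+1 => [set q * x | x in cantor_approx q k'] `|`
             [set q * x + 1 - q | x in cantor_approx q k']
  end.

(* [a i, b i] is the interval I_{k,i+1}: indices in 'I_(2 ^ k) start at 0.
   Existence of such endpoints is cantor_intervals_exist below. *)
Definition cantor_intervals (R : realType) (q : R) (k : nat)
    (a b : 'I_(2 ^ k) -> R) : Prop :=
  [/\ cantor_approx q k = \bigcup_(i in [set: 'I_(2 ^ k)]) [set` `[a i, b i]],
      forall i, b i - a i = q ^+ k,
      trivIset [set: 'I_(2 ^ k)] (fun i => [set` `[a i, b i]])
    & forall i j : 'I_(2 ^ k), (i < j)%N -> a i < a j].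

Definition log_matrix (R : realType) (m : nat) (r : R) (w : 'I_m -> R) :
    'M[R]_m :=
  \matrix_(i, j) (if i == j then - ln r else - ln `|w i - w j|).

(* Left endpoints: the first 2^(k-1) intervals of E_k come from q E_{k-1}, the
   others from q E_{k-1} + 1 - q. *)
Fixpoint cantor_left (R : realType) (q : R) (k j : nat) : R :=
  match k with
  | 0%N => 0
  | k'.+1 => if (j < 2 ^ k')%N then q * cantor_left q k' j
             else q * cantor_left q k' (j - 2 ^ k') + 1 - q
  end.

Section CantorIntervals.
Variables (R : realType) (q : R).
Hypotheses (q0 : 0 < q) (q12 : q < 2^-1).

Let subn_expn2 k j : (j < 2 ^ k.+1)%N -> ~~ (j < 2 ^ k)%N ->
  (j - 2 ^ k < 2 ^ k)%N.
Proof.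
by rewrite -leqNgt expnS mul2n -addnn => h1 h2; rewrite ltn_subLR.
Qed.

Lemma cantor_left_bounds k j : (j < 2 ^ k)%N ->
  0 <= cantor_left q k j /\ cantor_left q k j + q ^+ k <= 1.
Proof.
elim: k j => [|k IH] j hj /=; first by rewrite expr0 add0r.
have qk : 0 < q ^+ k by rewrite exprn_gt0.
rewrite exprS; case: ifPn => h.
- have [h1 h2] := IH _ h; split; first by rewrite mulr_ge0 // ltW.
  have : q * (cantor_left q k j + q ^+ k) <= q * 1 by rewrite ler_pM2l.
  by move: q12; lra.
- have [h1 h2] := IH _ (subn_expn2 hj h).
  have : 0 <= q * cantor_left q k (j - 2 ^ k) by rewrite mulr_ge0 // ltW.
  have : q * (cantor_left q k (j - 2 ^ k) + q ^+ k) <= q * 1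
    by rewrite ler_pM2l.
  by move: q12; split; lra.
Qed.

Lemma cantor_left_sep k i j : (i < j)%N -> (j < 2 ^ k)%N ->
  cantor_left q k i + q ^+ k < cantor_left q k j.
Proof.
elim: k i j => [|k IH] i j hij hj /=.
  by move: hj; rewrite expn0 ltnS leqn0 => /eqP j0; rewrite j0 in hij.
rewrite exprS; case: ifPn => hi; case: ifPn => h.
- by rewrite -mulrDr ltr_pM2l // IH.
- have [_ h2] := cantor_left_bounds hi.
  have [h3 _] := cantor_left_bounds (subn_expn2 hj h).
  have : q * (cantor_left q k i + q ^+ k) <= q * 1 by rewrite ler_pM2l.
  have : 0 <= q * cantor_left q k (j - 2 ^ k) by rewrite mulr_ge0 // ltW.
  by move: q12; lra.
- by case/negP: hi; apply: ltn_trans h.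
- have := IH (i - 2 ^ k)%N (j - 2 ^ k)%N.
  rewrite ltn_sub2r //; last by apply: leq_ltn_trans hij; rewrite leqNgt.
  move=> /(_ isT (subn_expn2 hj h)); rewrite -(ltr_pM2l q0).
  by lra.
Qed.

Lemma cantor_approxE k : cantor_approx q k =
  [set x | exists2 j, (j < 2 ^ k)%N &
     cantor_left q k j <= x <= cantor_left q k j + q ^+ k].
Proof.
elim: k => [|k IH] /=.
  apply/seteqP; split => x /=; rewrite in_itv /=.
    by move=> h; exists 0%N; rewrite // expr0 add0r.
  by case=> j _; rewrite expr0 add0r.
rewrite IH; apply/seteqP; split => x /=.
- case=> -[y [j hj /andP[h1 h2]] <-].
  + exists j; first by rewrite expnS mul2n -addnn ltn_addr.
    by rewrite hj exprS -mulrDr !ler_pM2l // h1 h2.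
  + exists (j + 2 ^ k)%N; first by rewrite expnS mul2n -addnn ltn_add2r.
    rewrite ltnNge leq_addl /= addnK exprS.
    have : q * cantor_left q k j <= q * y by rewrite ler_pM2l.
    have : q * y <= q * (cantor_left q k j + q ^+ k) by rewrite ler_pM2l.
    by move=> h3 h4; apply/andP; split; lra.
- case=> j hj; rewrite exprS; case: ifPn => h /andP[h1 h2].
  + left; exists (x / q); last by rewrite mulrC divfK ?gt_eqF.
    exists j => //; rewrite ler_pdivlMr // ler_pdivrMr //.
    by apply/andP; split; lra.
  + right; exists ((x - 1 + q) / q).
      exists (j - 2 ^ k)%N; first exact: subn_expn2.
      rewrite ler_pdivlMr // ler_pdivrMr //.
      by apply/andP; split; lra.
    by rewrite [q * _]mulrC divfK ?gt_eqF //; lra.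
Qed.

Lemma cantor_intervals_exist k :
  exists a b : 'I_(2 ^ k) -> R, cantor_intervals q a b.
Proof.
exists (fun i => cantor_left q k i), (fun i => cantor_left q k i + q ^+ k).
split.
- rewrite cantor_approxE; apply/seteqP; split => x /=.
    by case=> j hj h; exists (Ordinal hj) => //=; rewrite in_itv.
  by case=> j _ /=; rewrite in_itv /=; exists j.
- by move=> i; lra.
- move=> i j _ _ [x [/=]]; rewrite !in_itv /= => /andP[h1 h2] /andP[h3 h4].
  apply/val_inj; case: (ltngtP i j) => // hij.
  + by exfalso; have := cantor_left_sep hij (ltn_ord j); lra.
  + by exfalso; have := cantor_left_sep hij (ltn_ord i); lra.
- move=> i j hij; have := cantor_left_sep hij (ltn_ord j).
  by have : 0 < q ^+ k; [rewrite exprn_gt0|lra].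
Qed.

End CantorIntervals.

(* Main.v *)
Require Import Defs.
From mathcomp Require Import all_boot all_order all_algebra.
From mathcomp Require Import all_classical all_reals all_analysis.
From mathcomp Require Import lra.
Set Implicit Arguments.
Unset Strict Implicit.
Import Order.TTheory GRing.Theory Num.Theory.
Local Open Scope ring_scope.

(** The function [- ln] is strictly decreasing on positive numbers, so every
claim is about distances between midpoints, with the diagonal entry playing
the role of a point at distance [r] from itself.

Two disjoint closed intervals of length [2 * r] whose left endpoints are
ordered have midpoints more than [2 * r] apart ([cantor_intervals_gap]).
Hence every off-diagonal distance exceeds [r], which makes the diagonal entry
the strict maximum of its row and gives the upper bound [ln (1 / r)]; away from
the diagonal the distances in a row increase because the midpoints do.  These
two facts are the content of [log_matrix_decay]; the columns follow since the
matrix is symmetric.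

All intervals lie in [0, 1] ([cantor_intervals_sub01]), so the midpoints lie in
[r, 1 - r] and their distances are at most [1 - 2 * r].  The diagonal entry
obeys the same lower bound as soon as [r <= 1 - 2 * r], that is [3 * r <= 1],
and for [k >= 1] one even has [r < 1 / 4]. *)

Lemma log_matrix_sym (R : realType) (m : nat) (r : R) (w : 'I_m -> R) i j :
  log_matrix r w i j = log_matrix r w j i.
Proof. by rewrite !mxE eq_sym distrC. Qed.

Lemma ltrN_ln (R : realType) (x y : R) : 0 < x -> x < y -> - ln y < - ln x.
Proof.
by move=> x0 xy; rewrite ltrN2 ltr_ln // posrE //; apply: lt_trans xy.
Qed.

Lemma lerN_ln (R : realType) (x y : R) : 0 < x -> x <= y -> - ln y <= - ln x.
Proof.
by move=> x0 xy; rewrite lerN2 ler_ln // posrE //; apply: lt_le_trans xy.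
Qed.

(** Decay holds for any increasing family of points more than [r] apart:
this gap is what places the diagonal entry above all the
others. *)
Lemma log_matrix_decay (R : realType) (m : nat) (r : R) (w : 'I_m -> R) :
    0 < r -> (forall i j : 'I_m, (i < j)%N -> w i + r < w j) ->
  forall i : 'I_m,
     (forall j1 j2 : 'I_m, (j1 < j2 <= i)%N ->
        log_matrix r w i j1 < log_matrix r w i j2)
  /\ (forall j1 j2 : 'I_m, (i <= j1 < j2)%N ->
        log_matrix r w i j2 < log_matrix r w i j1).
Proof.
move=> r0 gap i; split=> j1 j2 /andP[]; rewrite !mxE.
- move=> h12 h2i; have h1i := leq_trans h12 h2i.
  have g1 := gap _ _ h1i; have g12 := gap _ _ h12.
  rewrite -!val_eqE /= (gtn_eqF h1i) [`|w i - w j1|]ger0_norm; last by lra.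
  case: eqP => [_|/eqP ne]; first by apply: ltrN_ln => //; lra.
  have g2 : w j2 + r < w i by apply: gap; rewrite ltn_neqAle eq_sym ne.
  by rewrite ger0_norm; [apply: ltrN_ln; lra|lra].
- move=> hi1 h12; have hi2 := leq_ltn_trans hi1 h12.
  have g2 := gap _ _ hi2; have g12 := gap _ _ h12.
  rewrite -!val_eqE /= (ltn_eqF hi2) [`|w i - w j2|]ler0_norm; last by lra.
  case: eqP => [_|/eqP ne]; first by apply: ltrN_ln => //; lra.
  have g1 : w i + r < w j1 by apply: gap; rewrite ltn_neqAle ne.
  by rewrite ler0_norm; [apply: ltrN_ln; lra|lra].
Qed.

Lemma log_matrix_bounds (R : realType) (m : nat) (r d : R) (w : 'I_m -> R) :
    0 < r -> r <= d ->
    (forall i j : 'I_m, i != j -> r <= `|w i - w j| <= d) ->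
  forall i j : 'I_m, - ln d <= log_matrix r w i j <= - ln r.
Proof.
move=> r0 rd dist i j; rewrite mxE; case: eqP => [_|/eqP ne].
  by rewrite lexx lerN_ln.
have /andP[h1 h2] := dist _ _ ne.
by rewrite !lerN_ln //; apply: lt_le_trans h1.
Qed.

Section CantorIntervalsTheory.
Variables (R : realType) (q : R) (k : nat).
Hypotheses (q0 : 0 < q) (q12 : q < 2^-1).
Variables (a b : 'I_(2 ^ k) -> R).
Hypothesis hI : cantor_intervals q a b.

(** Otherwise [a j] would belong to both intervals. *)
Lemma cantor_intervals_gap (i j : 'I_(2 ^ k)) : (i < j)%N -> b i < a j.
Proof.
case: hI => _ len disj inc hij; rewrite ltNge; apply/negP => haj.
have hlt := inc _ _ hij; have qk : 0 < q ^+ k by rewrite exprn_gt0.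
have lenj := len j.
have eij : i = j.
  apply: disj => //; exists (a j) => /=; rewrite !in_itv /=.
  by split; apply/andP; split; lra.
by rewrite eij ltnn in hij.
Qed.

Lemma cantor_intervals_sub01 (i : 'I_(2 ^ k)) : 0 <= a i /\ b i <= 1.
Proof.
case: hI => cover len _ _; have qk : 0 < q ^+ k by rewrite exprn_gt0.
have sub01 x : a i <= x <= b i -> 0 <= x <= 1.
  move=> hx; have : cantor_approx q k x.
    by rewrite cover; exists i => //=; rewrite in_itv.
  rewrite cantor_approxE // => -[j hj /andP[h1 h2]].
  have [h3 h4] := cantor_left_bounds q0 q12 hj.
  by apply/andP; split; lra.
have leni := len i.
have /andP[ha _] : 0 <= a i <= 1 by apply: sub01; apply/andP; split; lra.
have /andP[_ hb] : 0 <= b i <= 1 by apply: sub01; apply/andP; split; lra.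
by [].
Qed.

End CantorIntervalsTheory.

Theorem theorem3p3 (R : realType) (q : R) (k : nat)
    (hq0 : 0 < q) (hq12 : q < 2^-1) (hk : (1 <= k)%N)
    (a b : 'I_(2 ^ k) -> R) (hI : cantor_intervals q a b) :
  let r : R := 2^-1 * q ^+ k in
  let w : 'I_(2 ^ k) -> R := fun j => (a j + b j) / 2 in
  let A : 'M[R]_(2 ^ k) := log_matrix r w in
  [/\ forall i j : 'I_(2 ^ k), ln (1 / (1 - 2 * r)) <= A i j <= ln (1 / r),
      forall i : 'I_(2 ^ k),
                (forall j1 j2 : 'I_(2 ^ k), (j1 < j2 <= i)%N -> A i j1 < A i j2)
             /\ (forall j1 j2 : 'I_(2 ^ k), (i <= j1 < j2)%N -> A i j2 < A i j1)
    & forall j : 'I_(2 ^ k),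
                (forall i1 i2 : 'I_(2 ^ k), (i1 < i2 <= j)%N -> A i1 j < A i2 j)
             /\ (forall i1 i2 : 'I_(2 ^ k), (j <= i1 < i2)%N -> A i2 j < A i1 j)].
Proof.
move=> r w A.
have qk : 0 < q ^+ k by rewrite exprn_gt0.
have r0 : 0 < r by rewrite /r; lra.
have len i : b i - a i = 2 * r by case: hI => _ -> _ _; rewrite /r; lra.
have gap (i j : 'I_(2 ^ k)) : (i < j)%N -> w i + r < w j.
  move=> /(cantor_intervals_gap hq0 hI); rewrite /w.
  by have := len i; have := len j; lra.
have decay := log_matrix_decay r0 gap.
split=> //; last first.
  move=> j; have [dl dr] := decay j.
  by split=> i1 i2 hi; rewrite /A ![log_matrix _ _ _ j]log_matrix_sym;
    [apply: dl|apply: dr].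
have r14 : r < 4^-1.
  have : q ^+ k <= q.
    by rewrite -[leRHS]expr1 ler_wiXn2l // ?ltW //; lra.
  by rewrite /r; lra.
have dist_up (i j : 'I_(2 ^ k)) : w j - w i <= 1 - 2 * r.
  have [hai hbi] := cantor_intervals_sub01 hq0 hq12 hI i.
  have [haj hbj] := cantor_intervals_sub01 hq0 hq12 hI j.
  by rewrite /w; have := len i; have := len j; lra.
rewrite !div1r !lnV ?posrE //; last by lra.
apply: log_matrix_bounds => // [|i j ne]; first by lra.
rewrite ler_norml; have u1 := dist_up i j; have u2 := dist_up j i.
have -> /= : r <= `|w i - w j|.
  rewrite ler_normr; case: (ltngtP i j) => [|h|h].
  - by move=> /gap ?; apply/orP; right; lra.
  - by apply/orP; left; have := gap _ _ h; lra.
  - by move/val_inj: h ne => ->; rewrite eqxx.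
by apply/andP; split; lra.
Qed.
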